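(* Let $n$ be an even positive integer and let $G=\mathrm{Cay}(\mathbb{Z}_n,S)$ be a circulant graph of order $n$ with generating set $S$ such that $|S|=\frac n2-2$, $s_i+s_j\ne\frac n2$ for all $s_i,s_j\in S$, and $\frac n2\notin S$. Then $\chi''(G)\le\frac n2+1=\Delta(G)+3$.
   Context: All graphs are finite, simple and undirected. For a group $H$ and a symmetric generating set $S\subset H$ (that is, $s\in S$ implies $s^{-1}\in S$) not containing the identity, the Cayley graph $\mathrm{Cay}(H,S)$ has vertex set $H$ and edges joining $g$ and $gs$ for $g\in H$, $s\in S$. A circulant graph is a Cayley graph on the cyclic group $H=\mathbb{Z}_n$, whose elements are written $0,1,\ldots,n-1$; sums of elements of $S$ are taken in $\mathbb{Z}_n$. A total coloring of $G$ is a coloring of its vertices and edges such that no two adjacent vertices, no two adjacent edges, and no edge and a vertex incident with it receive the same color; $\chi''(G)$ is the minimum number of colors in a total coloring, and $\Delta(G)$ is the maximum degree. *)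

(* Defs.v *)
From mathcomp Require Import all_boot all_fingroup.

Set Implicit Arguments.
Unset Strict Implicit.
Unset Printing Implicit Defensive.

Record sgraph (T : finType) := SGraph {
  adj :> rel T;
  adj_sym : symmetric adj;
  adj_irr : irreflexive adj
}.

Section TotalColoring.
Variables (T : finType) (G : sgraph T).

Definition edges : {set {set T}} := [set [set x; y] | x in T, y in T & G x y].

Definition edge : finType := {e : {set T} | e \in edges}.

Definition max_degree : nat := \max_(x : T) #|[set y | G x y]|.

(* The elements to be colored are the vertices (inl) and the edges (inr). *)
Definition conflict (a b : T + edge) : bool :=
  match a, b with
  | inl u, inl v => G u v
  | inr e, inr f => (e != f) && (val e :&: val f != set0)
  | inl v, inr e | inr e, inl v => v \in val e
  end.

Definition total_coloring (k : nat) (c : {ffun T + edge -> 'I_k}) : bool :=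
  [forall a, forall b, conflict a b ==> (c a != c b)].

Definition total_colorable (k : nat) : bool :=
  [exists c : {ffun T + edge -> 'I_k}, total_coloring c].

Lemma conflict_irr : irreflexive conflict.
Proof. by case=> [u|e] /=; rewrite ?adj_irr ?eqxx. Qed.

Lemma total_colorable_ex : exists k, total_colorable k.
Proof.
exists #|{: T + edge}|; apply/existsP; exists [ffun a => enum_rank a].
apply/forallP=> a; apply/forallP=> b; apply/implyP; rewrite !ffunE.
by apply: contraL => /eqP/enum_rank_inj->; rewrite conflict_irr.
Qed.

Definition total_chromatic_number : nat := ex_minn total_colorable_ex.

End TotalColoring.

(* That S generates the whole group is not needed for Cay to be a simple graph;
   where it is assumed, it is the separate hypothesis <<S>> = [set: gT]. *)
Section Cayley.
Variables (gT : finGroupType) (S : {set gT}).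
Hypotheses (symS : {in S, forall s, (s^-1)%g \in S}) (S1 : 1%g \notin S).

Definition cayley_rel : rel gT := fun g h => [exists s in S, h == (g * s)%g].

Lemma cayley_sym : symmetric cayley_rel.
Proof.
suff H g h : cayley_rel g h -> cayley_rel h g by move=> g h; apply/idP/idP; exact: H.
case/exists_inP=> s sS /eqP->; apply/exists_inP; exists (s^-1)%g; first exact: symS.
by rewrite mulgK.
Qed.

Lemma cayley_irr : irreflexive cayley_rel.
Proof.
move=> g; apply/negbTE/exists_inP=> -[s sS]; rewrite -{1}[g]mulg1.
by move=> /eqP/mulgI s1; move: S1; rewrite s1 sS.
Qed.

Definition Cay : sgraph gT := SGraph cayley_sym cayley_irr.

End Cayley.

(* Main.v *)
Require Import Defs.
From mathcomp Require Import all_boot all_algebra all_fingroup.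
From mathcomp Require Import zify.

(** Write [n = 2m]. Since [m] is not in [S], and no two elements of the symmetric
    set [S] differ by [m], reduction modulo [m] is injective on every closed
    neighborhood of [G]. Hence a total coloring of the complete graph on [Z_m]
    pulls back to [G]. For an odd [N >= m], coloring the vertex [i] with [2i mod N]
    and the edge [ij] with [i + j mod N] is a total coloring of that complete
    graph; one of [m], [m + 1] is a valid choice of [N]. *)

Lemma eqn_modDl_lt (N a b c : nat) :
  b < N -> c < N -> a + b = a + c %[mod N] -> b = c.
Proof. by move=> bN cN /eqP; rewrite eqn_modDl !modn_small // => /eqP. Qed.

(** Both doubles have quotient 0 or 1 by [N]. If the quotients differed, two even numbers would
    differ by the odd number [N]. *)
Lemma eqn_mod_double_lt (N a b : nat) : odd N ->
  a < N -> b < N -> a + a = b + b %[mod N] -> a = b.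
Proof.
move=> oN aN bN eab; have := divn_eq (a + a) N; have := divn_eq (b + b) N.
have lt2 c : c < N -> (c + c) %/ N < 2 by move=> cN; rewrite ltn_divLR; lia.
rewrite -eab; case: (_ %/ _) (lt2 b bN) => [|[|//]] _;
  case: (_ %/ _) (lt2 a aN) => [|[|//]] _; lia.
Qed.

Lemma in_edgesP (T : finType) (G : sgraph T) (e : {set T}) :
  reflect (exists x y, G x y /\ e = [set x; y]) (e \in edges G).
Proof.
apply: (iffP imset2P) => [[x y _]|[x [y [Gxy ->]]]].
  by rewrite inE => /andP[_ Gxy] ->; exists x, y.
by exists x y; rewrite ?inE.
Qed.

Lemma edge_incidentP (T : finType) (G : sgraph T) (e : edge G) (x : T) :
  x \in val e -> exists2 y, G x y & val e = [set x; y].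
Proof.
have /in_edgesP[a [b [Gab ->]]] := valP e.
rewrite !inE => /orP[] /eqP->; first by exists b.
by exists a; rewrite 1?adj_sym // setUC.
Qed.

Lemma total_colorable_locally_injective (T : finType) (G : sgraph T)
    (N k : nat) (p : T -> nat) : odd N -> N <= k ->
    (forall x, p x < N) ->
    (forall x y, G x y -> p x <> p y) ->
    (forall x y z, G x y -> G x z -> p y = p z -> y = z) ->
  total_colorable G k.
Proof.
move=> oN Nk pN padj pnbr.
have N_gt0 : 0 < N by case: (N) oN.
(* Summing over the edge as a set avoids ordering its endpoints; reduction modulo [N] comes only
   with the final coloring. *)
pose w (a : T + edge G) : nat :=
  match a with inl x => p x + p x | inr e => \sum_(x in val e) p x end.
have w_edge (e : edge G) x y : G x y -> val e = [set x; y] ->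
    w (inr e) = p x + p y.
  move=> Gxy /= ->; rewrite big_setU1 ?big_set1 // inE.
  by apply: contraTneq Gxy => ->; rewrite adj_irr.
have w_lt a : w a %% N < k by apply: leq_trans Nk; rewrite ltn_mod.
have w_vertex_edge x (e : edge G) : x \in val e ->
    w (inl x) <> w (inr e) %[mod N].
  case/edge_incidentP=> y Gxy def_e; rewrite (w_edge e _ _ Gxy def_e).
  by move/eqn_modDl_lt=> /(_ (pN x) (pN y)); exact: padj.
apply/existsP; exists [ffun a => Ordinal (w_lt a)].
apply/forallP=> a; apply/forallP=> b; apply/implyP=> cab; rewrite !ffunE.
apply/negP=> /eqP/(congr1 val).
rewrite [RHS]/= [LHS]/=; case: a b cab => [x|e] [y|f] cab.
- by move/(eqn_mod_double_lt _ _ _ oN (pN x) (pN y)); exact: padj.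
- exact: w_vertex_edge.
- by move/esym; exact: w_vertex_edge.
(* Two edges sharing [x]: cancelling [p x] leaves two neighbors of [x] with the same value of
   [p]. *)
case/andP: cab => nef /set0Pn[x /setIP[xe xf]].
have [y Gxy def_e] := edge_incidentP _ _ _ _ xe.
have [z Gxz def_f] := edge_incidentP _ _ _ _ xf.
rewrite (w_edge e _ _ Gxy def_e) (w_edge f _ _ Gxz def_f).
move/eqn_modDl_lt=> /(_ (pN y) (pN z)) /(pnbr _ _ _ Gxy Gxz) eyz.
by case/negP: nef; apply/eqP/val_inj; rewrite def_e def_f eyz.
Qed.

Lemma max_degree_Cay (gT : finGroupType) (S : {set gT})
    (symS : {in S, forall s, (s^-1)%g \in S}) (S1 : 1%g \notin S) :
  max_degree (Cay symS S1) = #|S|.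
Proof.
have degS x : #|[set y | Cay symS S1 x y]| = #|S|.
  (* The neighborhood of [x] is the left translate of [S] by [x]. *)
  rewrite -(card_imset S (mulgI x)); congr #|pred_of_set _|.
  apply/setP=> y; rewrite inE; apply/exists_inP/imsetP => [[s sS /eqP->]|[s sS ->]];
  by exists s.
apply/eqP; rewrite eqn_leq -{2}(degS 1%g) leq_bigmax andbT.
by apply/bigmax_leqP=> x _; rewrite degS.
Qed.

(** Division by [m = n./2] writes each element as [q * m + r] with [q] equal to 0 or 1, so equal
    remainders leave a difference of 0 or [m] up to sign. *)
Lemma Zp_eq_mod_half (n : nat) (x y : 'Z_n) : 1 < n -> ~~ odd n ->
  x %% n./2 = y %% n./2 -> x = y \/ (x - y = n./2%:R)%R.
Proof.
move=> n_gt1 n_even; set m := n./2 => exy.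
have def_n : n = m + m by rewrite /m; lia.
have mm0 : (m%:R + m%:R = 0 :> 'Z_n)%R by rewrite -GRing.natrD -def_n pchar_Zp.
have lt2m (z : 'Z_n) : z %/ m < 2.
  have := ltn_ord z; rewrite [X in _ < X]Zp_cast // => zn.
  by rewrite ltn_divLR; lia.
have decomp (z : 'Z_n) : z = ((z %/ m)%:R * m%:R + (z %% m)%:R)%R.
  by rewrite -GRing.natrM -GRing.natrD -divn_eq natr_Zp.
rewrite (decomp x) (decomp y) exy.
case: (x %/ m) (lt2m x) => [|[|//]] _; case: (y %/ m) (lt2m y) => [|[|//]] _;
  rewrite ?GRing.mul0r ?GRing.mul1r ?GRing.add0r; try by left.
(* Here [x - y = - m], which is [m] since [m + m = 0] in ['Z_n]. *)
- by right; rewrite GRing.opprD GRing.addrCA GRing.subrr GRing.addr0;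
    apply/eqP; rewrite eq_sym -GRing.addr_eq0 mm0.
- by right; rewrite GRing.addrK.
Qed.

Theorem theorem3p2 (n : nat) (n_gt0 : 0 < n) (n_even : ~~ odd n)
    (S : {set 'Z_n})
    (genS : <<S>>%g = [set: 'Z_n])
    (symS : {in S, forall s, (s^-1)%g \in S})
    (S1 : 1%g \notin S)
    (cardS : #|S| + 2 = n./2)
    (sumS : forall s t : 'Z_n, s \in S -> t \in S -> (s + t)%R <> (n./2)%:R%R)
    (halfS : (n./2)%:R%R \notin S) :
  total_chromatic_number (Cay symS S1) <= n./2 + 1 /\
  n./2 + 1 = max_degree (Cay symS S1) + 3.
Proof.
split; last by rewrite max_degree_Cay -cardS -addnA.
(* [cardS] gives [n./2 >= 2]; ['Z_n] has exactly [n] elements only when [n > 1]. *)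
have n_gt1 : 1 < n by lia.
have adjP (x y : 'Z_n) : Cay symS S1 x y -> (y - x)%R \in S.
  by case/exists_inP=> s sS /eqP->; rewrite [(x * s)%g]GRing.addrC GRing.addrK.
rewrite /total_chromatic_number; case: ex_minnP => k _; apply.
pose N := n./2 + ~~ odd n./2.
apply: (@total_colorable_locally_injective _ _ N _ (fun x : 'Z_n => x %% n./2)).
- by rewrite /N; lia.
- by rewrite /N; lia.
- move=> x; apply: (@leq_trans n./2); last exact: leq_addr.
  by rewrite ltn_mod; lia.
- move=> x y Gxy /esym/(Zp_eq_mod_half _ _ _ n_gt1 n_even)[eyx|eyx].
    by rewrite eyx adj_irr in Gxy.
  by move/adjP: Gxy; rewrite eyx (negPf halfS).
move=> x y z /adjP Sxy /adjP Sxz /(Zp_eq_mod_half _ _ _ n_gt1 n_even)[//|eyz].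
(* If [y - z] were [n./2], then [y - x] and [x - z], both in [S], would sum to [n./2], against
   [sumS]. *)
have Szx : (- (z - x : 'Z_n))%R \in S := symS _ Sxz.
by case: (sumS _ _ Sxy Szx); rewrite -eyz GRing.opprB GRing.addrA GRing.subrK.
Qed.
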